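(* Let $n\ge 3$ and let $M$ be a constant. There is a constant $\beta_0=\beta_0(n,M)$, depending only on $n$ and $M$, such that the following holds. If $\psi\in C(\mathbb{B}^n,\mathbb{R}^n)$ satisfies $|\psi(x)|\le M(1-|x|^2)$ for all $x\in\mathbb{B}^n$ and $\Psi=G_h[\psi]$, then for all $x,y\in\mathbb{B}^n$, $$|\Psi(x)-\Psi(y)|\le\beta_0|x-y|.$$
   Context: $\mathbb{B}^n$ is the open unit ball of $\mathbb{R}^n$; $\nu$ is $n$-dimensional Lebesgue measure normalized by $\nu(\mathbb{B}^n)=1$; $d\tau(x)=(1-|x|^2)^{-n}\,d\nu(x)$. For $x,y\in\mathbb{B}^n$ let $[x,y]\ge 0$ be given by $[x,y]^2=|x-y|^2+(1-|x|^2)(1-|y|^2)$, and let $|\varphi_x(y)|=\frac{|x-y|}{[x,y]}$. The Green function is $G_h(x,y)=\frac1n\int_{|\varphi_x(y)|}^1\frac{(1-s^2)^{n-2}}{s^{n-1}}\,ds$ for $x\ne y$, and $G_h[\psi](x)=\int_{\mathbb{B}^n}G_h(x,y)\psi(y)\,d\tau(y)$. *)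

(* Defs.v *)
From HB Require Import structures.
From mathcomp Require Import all_boot all_order all_algebra.
From mathcomp Require Import all_classical all_reals all_analysis.
From mathcomp Require Import measurable_realfun.

Set Implicit Arguments.
Unset Strict Implicit.
Unset Printing Implicit Defensive.

Import Order.TTheory GRing.Theory Num.Theory.
Import numFieldNormedType.Exports.

Local Open Scope classical_set_scope.
Local Open Scope ring_scope.

(* R^n is 'rV[R]_n; its sigma-algebra is generated by the coordinates, which
   makes it the Borel sigma-algebra of the matrix topology. *)

Section measurable_rV.
Context {R : realType} (n : nat).

Let coors (i : 'I_n) (v : 'rV[R]_n) : R := v 0 i.

Let rV_set0 : g_sigma_preimage coors set0.
Proof. exact: sigma_algebra0. Qed.

Let rV_setC A : g_sigma_preimage coors A -> g_sigma_preimage coors (~` A).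
Proof. exact: sigma_algebraC. Qed.

Let rV_bigcup (F : (set 'rV[R]_n)^nat) :
  (forall i, g_sigma_preimage coors (F i)) ->
  g_sigma_preimage coors (\bigcup_i (F i)).
Proof. exact: sigma_algebra_bigcup. Qed.

HB.instance Definition _ := @isMeasurable.Build default_measure_display
  'rV[R]_n (g_sigma_preimage coors) rV_set0 rV_setC rV_bigcup.

End measurable_rV.

Lemma measurable_coord (R : realType) (n : nat) (i : 'I_n) :
  measurable_fun [set: 'rV[R]_n]
    (fun v : 'rV[R]_n => v 0 i).
Proof.
move=> _ Y mY; rewrite setTI; apply: sub_sigma_algebra => /=.
rewrite -bigcup_seq/=; exists i => /=; first by rewrite mem_index_enum.
by exists Y => //; rewrite setTI.
Qed.

Lemma measurable_fun_coordP d (T : measurableType d) (R : realType) (n : nat)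
    (f : T -> 'rV[R]_n) :
  measurable_fun [set: T] f <->
  forall i, measurable_fun [set: T] (fun t => f t 0 i).
Proof.
split=> [mf i|mf].
  exact: (measurableT_comp (measurable_coord i) mf).
apply: (@measurability _ _ T 'rV[R]_n setT f
  (\big[setU/set0]_(i < n) preimage_set_system setT
    (fun v : 'rV[R]_n => v 0 i) measurable)) => //.
move=> _ [B + <-].
rewrite -bigcup_seq /= => -[i /= _ [A mA <-]].
by rewrite [X in measurable X](_ : _ = setT `&` (fun t => f t 0 i) @^-1` A);
  [exact: mf|rewrite !setTI].
Qed.

(* (t, v) |-> (t, v_0, ..., v_(n-1)) *)
Definition cons_rV (R : realType) (n : nat)
    (p : measurableTypeR R * 'rV[R]_n) : 'rV[R]_n.+1 :=
  \row_i (if unlift ord0 i is Some j then p.2 0 j else p.1).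

Lemma measurable_cons_rV (R : realType) (n : nat) :
  measurable_fun setT (@cons_rV R n).
Proof.
apply/measurable_fun_coordP => i.
under eq_fun do rewrite mxE.
case: (unlift ord0 i) => [j|]; last exact: measurable_fst.
exact: (measurableT_comp (measurable_coord j) measurable_snd).
Qed.

Section lebesgue_rV_succ.
Local Open Scope ereal_scope.
Context {R : realType} {n : nat}.
Variable mu : {sigma_finite_measure set 'rV[R]_n -> \bar R}.

Let prod : {measure set (measurableTypeR R * 'rV[R]_n)%type -> \bar R} :=
  @lebesgue_measure R \x mu.

Definition lebesgue_rV_succ (A : set 'rV[R]_n.+1) : \bar R :=
  pushforward prod (@cons_rV R n) A.

Let succ0 : lebesgue_rV_succ set0 = 0.
Proof. by rewrite /lebesgue_rV_succ /pushforward preimage_set0 measure0. Qed.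

Let succ_ge0 A : 0 <= lebesgue_rV_succ A.
Proof. exact: (measure_ge0 prod). Qed.

Let succ_sigma_additive : semi_sigma_additive lebesgue_rV_succ.
Proof.
move=> F mF tF mUF; rewrite /lebesgue_rV_succ /pushforward preimage_bigcup.
have mcons B : measurable B -> measurable (@cons_rV R n @^-1` B).
  by move=> mB; rewrite -[X in measurable X]setTI; exact: measurable_cons_rV.
apply: (@measure_semi_sigma_additive _ _ _ prod).
- by move=> k; exact: mcons.
- apply/trivIsetP => /= i j _ _ ij; rewrite -preimage_setI.
  by move/trivIsetP : tF => /(_ _ _ _ _ ij) ->//; rewrite preimage_set0.
- by rewrite -preimage_bigcup; exact: mcons.
Qed.

HB.instance Definition _ := isMeasure.Build _ _ _ lebesgue_rV_succ
  succ0 succ_ge0 succ_sigma_additive.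

Let succ_sigma_finite : sigma_finite setT lebesgue_rV_succ.
Proof.
have /sigma_finiteP[F [UF ndF Foo]] := sigma_finiteT (@lebesgue_measure R).
have /sigma_finiteP[G [UG ndG Goo]] := sigma_finiteT mu.
pose uncons (v : 'rV[R]_n.+1) : measurableTypeR R * 'rV[R]_n :=
  (v ord0 ord0, \row_j v ord0 (lift ord0 j)).
have cons_rVK : cancel (@cons_rV R n) uncons.
  move=> [t v]; rewrite /uncons /cons_rV mxE unlift_none; congr pair.
  by apply/rowP => j; rewrite !mxE liftK.
have muncons : measurable_fun setT uncons.
  apply: measurable_fun_pair; first exact: measurable_coord.
  apply/measurable_fun_coordP => i.
  by under eq_fun do rewrite mxE; exact: measurable_coord.
exists (fun k => uncons @^-1` (F k `*` G k)).
  apply/seteqP; split => // v _.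
  have [k _ Fk] : (\bigcup_k F k) (uncons v).1 by rewrite -UF.
  have [l _ Gl] : (\bigcup_l G l) (uncons v).2 by rewrite -UG.
  exists (maxn k l) => //; split.
    by move: Fk; exact/subsetPset/ndF/leq_maxl.
  by move: Gl; exact/subsetPset/ndG/leq_maxr.
move=> k; have [mF Fk] := Foo k; have [mG Gk] := Goo k; split.
  rewrite -[X in measurable X]setTI; apply: muncons => //.
  exact: measurableX.
rewrite /lebesgue_rV_succ /pushforward -comp_preimage.
rewrite (_ : uncons \o @cons_rV R n = id); last by apply/funext => p /=.
by rewrite preimage_id /= product_measure1E// lte_mul_pinfty// ge0_fin_numE.
Qed.

HB.instance Definition _ := Measure_isSigmaFinite.Build _ _ _ lebesgue_rV_succ
  succ_sigma_finite.

End lebesgue_rV_succ.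

(* n-dimensional Lebesgue measure, as an iterated product; lebesgue_rV_box
   gives its value on boxes, which characterizes it. *)
Fixpoint lebesgue_rV {R : realType} (n : nat) :
    {sigma_finite_measure set 'rV[R]_n -> \bar R} :=
  match n with
  | 0 => @dirac _ 'rV[R]_0 0 R
  | m.+1 => lebesgue_rV_succ (lebesgue_rV m)
  end.

Lemma measurable_box (R : realType) (n : nat) (A : 'I_n -> set R) :
  (forall i, measurable (A i)) ->
  measurable [set v : 'rV[R]_n | forall i, A i (v 0 i)].
Proof.
move=> mA; rewrite [X in measurable X](_ : _ = \bigcap_(i in [set: 'I_n])
    (setT `&` (fun v : 'rV[R]_n => v 0 i) @^-1` A i)); last first.
  by apply/seteqP; split => [v /= Av i _|v Av i]; [split|case: (Av i I)].
apply: fin_bigcap_measurable => // i _.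
by apply: measurable_coord => //; exact: mA.
Qed.

Lemma lebesgue_rV_box (R : realType) (n : nat) (A : 'I_n -> set R) :
  (forall i, measurable (A i)) ->
  lebesgue_rV n [set v : 'rV[R]_n | forall i, A i (v 0 i)] =
  (\prod_(i < n) lebesgue_measure (A i : set (measurableTypeR R)))%E.
Proof.
elim: n => [|n IHn] in A * => mA.
  rewrite big_ord0 /= diracE mem_set// => -[].
  by case.
rewrite big_ord_recl /= /lebesgue_rV_succ /pushforward.
rewrite -IHn => [|i]; last exact: mA.
rewrite -product_measure1E; [|exact: mA|]; last first.
  by apply: (@measurable_box R n (fun i => A (lift ord0 i))) => i; exact: mA.
congr (_ _); apply/seteqP; split => [[t v] /= H|[t v] /= [At Av] i].
  split=> [|i]; first by have := H ord0; rewrite mxE unlift_none.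
  by have := H (lift ord0 i); rewrite mxE liftK.
by rewrite mxE; case: unliftP => [j ->|->].
Qed.

(* Euclidean norm; the library's `|x| on 'rV[R]_n is the sup norm. *)
Definition enorm (R : realType) (n : nat) (x : 'rV[R]_n) : R :=
  Num.sqrt (\sum_(i < n) x 0 i ^+ 2).

Definition unit_ball (R : realType) (n : nat) : set 'rV[R]_n :=
  [set x | enorm x < 1].
Arguments unit_ball {R} n.

Lemma enorm_lt1 (R : realType) (n : nat) (x : 'rV[R]_n) :
  (enorm x < 1) = (\sum_(i < n) x 0 i ^+ 2 < 1).
Proof. by rewrite /enorm -[X in _ < X]sqrtr1 ltr_sqrt. Qed.

Lemma measurable_unit_ball (R : realType) (n : nat) :
  measurable (@unit_ball R n).
Proof.
have msum : measurable_fun [set: 'rV[R]_n]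
    (fun x : 'rV[R]_n => \sum_(i < n) x 0 i ^+ 2).
  apply: measurable_sum => i.
  by apply: measurable_funX; exact: (measurable_coord i).
rewrite (_ : @unit_ball R n = [set: 'rV[R]_n] `&`
    (fun x : 'rV[R]_n => \sum_(i < n) x 0 i ^+ 2) @^-1` `]-oo, 1[%classic).
  by apply: msum => //; exact: measurable_itv.
by rewrite setTI; apply/seteqP; split => x /=; rewrite in_itv /= -enorm_lt1.
Qed.

Lemma lebesgue_unit_ball_gt0 (R : realType) (n : nat) :
  (0 < lebesgue_rV n (@unit_ball R n))%E.
Proof.
pose r : R := n.+2%:R^-1; have r0 : 0 < r by rewrite invr_gt0.
have mI (i : 'I_n) : measurable (`]-r, r[%classic : set (measurableTypeR R)).
  exact: measurable_itv.
rewrite (@lt_le_trans _ _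
    (lebesgue_rV n [set v : 'rV[R]_n | forall i, `]-r, r[%classic (v 0 i)]))//.
  rewrite (@lebesgue_rV_box R n (fun=> `]-r, r[%classic))//.
  rewrite (eq_bigr (fun=> (r + r)%:E)) => [|i _]; last first.
    by rewrite lebesgue_measure_itv /= lte_fin gtrN// -EFinB opprK.
  by rewrite prodEFin lte_fin prodr_gt0// => i _; rewrite addr_gt0.
apply: le_measure; rewrite ?inE; last 2 first.
- exact: measurable_unit_ball.
- move=> v /= vr; rewrite /unit_ball /= enorm_lt1.
  apply: (@le_lt_trans _ _ (\sum_(i < n) r ^+ 2)).
    apply: ler_sum => i _; have := vr i; rewrite /= in_itv /= => /andP[v1 v2].
    by rewrite -real_normK ?num_real// lerXn2r ?nnegrE ?(ltW r0)// ler_norml !ltW.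
  rewrite sumr_const card_ord -mulr_natr expr2 -mulrA.
  rewrite (@le_lt_trans _ _ (r * 1))//.
    rewrite ler_pM2l// /r ler_pdivrMl// mulr1 ler_nat.
    by rewrite ltnW.
  by rewrite mulr1 invf_lt1// ltr1n.
by apply: (@measurable_box R n (fun=> `]-r, r[%classic)) => i; exact: mI.
Qed.

Lemma lebesgue_unit_ball_lty (R : realType) (n : nat) :
  (lebesgue_rV n (@unit_ball R n) < +oo)%E.
Proof.
have mI (i : 'I_n) : measurable (`[-1, 1]%classic : set (measurableTypeR R)).
  exact: measurable_itv.
rewrite (@le_lt_trans _ _
    (lebesgue_rV n [set v : 'rV[R]_n | forall i, `[-1, 1]%classic (v 0 i)]))//.
  apply: le_measure; rewrite ?inE; first exact: measurable_unit_ball.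
    by apply: (@measurable_box R n (fun=> `[-1, 1]%classic)) => i; exact: mI.
  move=> v /=; rewrite /unit_ball /= enorm_lt1 => v1 i.
  rewrite /= in_itv /= -ler_norml -(@expr_le1 _ 2)// real_normK ?num_real//.
  apply: le_trans (ltW v1); rewrite (bigD1 i)//= lerDl.
  by apply: sumr_ge0 => j _; exact: sqr_ge0.
rewrite (@lebesgue_rV_box R n (fun=> `[-1, 1]%classic))//.
rewrite (eq_bigr (fun=> (1 + 1)%:E)) => [|i _]; last first.
  by rewrite lebesgue_measure_itv /= lte_fin gtrN// -EFinB opprK.
by rewrite prodEFin ltry.
Qed.

Section hyperbolic_green.
Context {R : realType} {n : nat}.
Implicit Types x y : 'rV[R]_n.

Let vol_inv_ge0 : 0 <= (fine (lebesgue_rV n (@unit_ball R n)))^-1.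
Proof. by rewrite invr_ge0 fine_ge0. Qed.

(* Lebesgue measure normalized by nu (unit_ball n) = 1, see nu_unit_ball. *)
Definition nu : set 'rV[R]_n -> \bar R :=
  mscale (NngNum vol_inv_ge0) (lebesgue_rV n).

HB.instance Definition _ := Measure.on nu.

(* [x, y] *)
Definition bracket x y : R :=
  Num.sqrt (enorm (x - y) ^+ 2 + (1 - enorm x ^+ 2) * (1 - enorm y ^+ 2)).

(* |phi_x(y)| *)
Definition norm_phi x y : R := enorm (x - y) / bracket x y.

(* Meaningful for x != y only; on the diagonal the integral diverges and
   Rintegral returns 0, which is irrelevant below since points are nu-null. *)
Definition green x y : R :=
  n%:R^-1 * \int[@lebesgue_measure R]_(s in `[norm_phi x y, 1])
              ((1 - s ^+ 2) ^+ (n - 2) / s ^+ (n - 1)).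

(* Componentwise integral against d tau = (1 - |y|^2)^-n d nu. *)
Definition green_potential (psi : 'rV[R]_n -> 'rV[R]_n) x : 'rV[R]_n :=
  \row_i \int[nu]_(y in unit_ball n)
           (green x y * psi y 0 i * (1 - enorm y ^+ 2) ^- n).

End hyperbolic_green.

Lemma nu_unit_ball (R : realType) (n : nat) : nu (@unit_ball R n) = 1%E.
Proof.
rewrite /nu /mscale /=.
have fL : lebesgue_rV n (@unit_ball R n) \is a fin_num.
  by rewrite ge0_fin_numE// lebesgue_unit_ball_lty.
rewrite -[X in (_ * X)%E]fineK// -EFinM mulVf// gt_eqF//.
by rewrite fine_gt0// lebesgue_unit_ball_gt0 lebesgue_unit_ball_lty.
Qed.

(* Main.v *)
Require Import Defs.
From mathcomp Require Import all_boot all_order all_algebra.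
From mathcomp Require Import all_classical all_reals all_analysis.
From mathcomp Require Import measurable_realfun ring lra.
Import Order.TTheory GRing.Theory Num.Theory.
Import numFieldNormedType.Exports.
Set Implicit Arguments.
Unset Strict Implicit.
Unset Printing Implicit Defensive.
Local Open Scope classical_set_scope.
Local Open Scope ring_scope.

(** The Lipschitz bound is obtained without differentiating under the integral
    sign: for fixed [x], [z] the two integrands are compared pointwise in [y],
    and the bound that results is integrated.

    Let [r] and [s] be the values of [|phi|] at [(x, y)] and [(z, y)], say
    [r <= s]. The Green function is a decreasing function of [|phi|], namely the
    integral over [[r, 1]] of a decreasing density, so that
      [n * |G(x,y) - G(z,y)| <= (s - r) * (1 - r^2)^(n-2) / r^(n-1)]
    ([green_tail_diff]). The increment [s - r] is controlled by the triangle
    inequality for the pseudo-hyperbolic distance [|phi|] in its strong form,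
    [s - r <= (1 - r s) |x - z| / [x,z]]. With the denominators cleared this is
      [[x,y] [z,y] <= (1 - |y|^2) [x,z] + |x - y| |z - y|]
    ([bracket_mul_le]), which is the Cauchy-Schwarz inequality for the images of
    [x] and [z] under the Moebius map [phi_y]. Since [[x,z] >= 1 - |x|], the
    difference is at most [|x - z| / (1 - |x|) * ((1 - r^2) / r)^(n-1)].

    From [1 - r^2 = (1 - |x|^2)(1 - |y|^2) / [x,y]^2] one gets a factor
    [(1 - |y|^2)^(n-1)], which exactly cancels what the bound on [psi] leaves of
    the weight of [tau]. What remains is, up to a constant,
      [|x - z| * delta^(n-2) / (max(delta, |x-y|) |x-y|)^(n-1)],
    where [delta = 1 - |x|] ([green_sub_le]). The integral of this kernel over
    the whole space does not change when [delta] and [x - y] are rescaled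
    together, and it is finite: near [x] it behaves like [|x-y|^(1-n)] and far
    away like [|x-y|^(2-2n)], where [2 - 2n < -n] because [n >= 3]. Instead of
    polar coordinates, the kernel is bounded by a sum of indicator functions of
    cubes of dyadic sizes [2^k delta] ([near_kernel_le_majorant]), whose
    integrals form a geometric series ([integral_majorant_le]). The sum is
    infinite at [y = x], so the bound also holds on the diagonal, whatever the
    value of the Green function there. *)

(** * Euclidean norm and inner product *)

Section dot.
Context {R : realType} {n : nat}.
Implicit Types u v w : 'rV[R]_n.

Definition dot u v : R := \sum_(i < n) u 0 i * v 0 i.

Lemma dotC u v : dot u v = dot v u.
Proof. by apply: eq_bigr => i _; rewrite mulrC. Qed.

Lemma dotBl u v w : dot (u - v) w = dot u w - dot v w.
Proof. by rewrite -sumrB; apply: eq_bigr => i _; rewrite !mxE mulrBl. Qed.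

Lemma dotBr u v w : dot w (u - v) = dot w u - dot w v.
Proof. by rewrite !(dotC w) dotBl. Qed.

Lemma dotZl a u v : dot (a *: u) v = a * dot u v.
Proof. by rewrite mulr_sumr; apply: eq_bigr => i _; rewrite !mxE mulrA. Qed.

Lemma dotZr a u v : dot u (a *: v) = a * dot u v.
Proof. by rewrite dotC dotZl dotC. Qed.

Definition dotE := (dotBl, dotBr, dotZl, dotZr).

Lemma dot_ge0 u : 0 <= dot u u.
Proof. by apply: sumr_ge0 => i _; exact: sqr_ge0. Qed.

Lemma dot_eq0 u : (dot u u == 0) = (u == 0).
Proof.
apply/idP/eqP => [|->]; last by rewrite /dot big1// => i _; rewrite mxE mul0r.
rewrite psumr_eq0 => [/allP u0|i _]; last exact: sqr_ge0.
apply/rowP => i; rewrite mxE; have := u0 i (mem_index_enum _).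
by rewrite mulf_eq0 orbb => /eqP.
Qed.

Lemma enorm_sq u : enorm u ^+ 2 = dot u u.
Proof.
rewrite sqr_sqrtr; last by apply: sumr_ge0 => i _; exact: sqr_ge0.
by apply: eq_bigr => i _; rewrite expr2.
Qed.

Lemma enorm_ge0 u : 0 <= enorm u.
Proof. exact: sqrtr_ge0. Qed.

Lemma enorm_eq0 u : (enorm u == 0) = (u == 0).
Proof. by rewrite -(@sqrf_eq0 _ (enorm u)) enorm_sq dot_eq0. Qed.

Lemma enorm_subC u v : enorm (u - v) = enorm (v - u).
Proof.
by rewrite /enorm; congr Num.sqrt; apply: eq_bigr => i _; rewrite !mxE; ring.
Qed.

Lemma cauchy_schwarz u v : `|dot u v| <= enorm u * enorm v.
Proof.
rewrite -(@ler_pXn2r _ 2)// ?nnegrE ?mulr_ge0 ?enorm_ge0//.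
rewrite real_normK ?num_real// exprMn !enorm_sq.
have [/eqP|v0] := eqVneq (dot v v) 0.
  rewrite dot_eq0 => /eqP ->.
  by rewrite -(subrr v) !dotBr !subrr expr0n/= mulr0.
have vv : 0 < dot v v by rewrite lt_def v0 dot_ge0.
have := dot_ge0 (dot v v *: u - dot u v *: v).
rewrite !dotE (dotC v u) => h.
rewrite -subr_ge0 -(pmulr_rge0 _ vv).
by apply: le_trans h _; rewrite le_eqVlt; apply/orP; left; apply/eqP; ring.
Qed.

Lemma coord_le_enorm u i : `|u 0 i| <= enorm u.
Proof.
rewrite -(@ler_pXn2r _ 2)// ?nnegrE ?enorm_ge0// real_normK ?num_real//.
rewrite enorm_sq /dot (bigD1 i)//= expr2 lerDl.
by apply: sumr_ge0 => j _; exact: sqr_ge0.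
Qed.

Lemma enorm_le_sum u : enorm u <= \sum_(i < n) `|u 0 i|.
Proof.
have s0 : 0 <= \sum_(i < n) `|u 0 i| by apply: sumr_ge0.
rewrite -(@ler_pXn2r _ 2)// ?nnegrE ?enorm_ge0// enorm_sq expr2 mulr_sumr.
apply: ler_sum => i _; rewrite (le_trans (ler_norm _))// normrM.
by apply: ler_wpM2r => //; rewrite (bigD1 i)//= lerDl sumr_ge0.
Qed.

End dot.

(** * Pseudo-hyperbolic distance *)

Section bracket.
Context {R : realType} {n : nat}.
Implicit Types x y z : 'rV[R]_n.

Lemma one_sub_enorm_gt0 x : unit_ball n x -> 0 < 1 - enorm x ^+ 2.
Proof. by move=> x1; rewrite subr_gt0 expr_lt1 ?enorm_ge0. Qed.

Lemma bracket_sq x y : unit_ball n x -> unit_ball n y ->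
  bracket x y ^+ 2 = enorm (x - y) ^+ 2 + (1 - enorm x ^+ 2) * (1 - enorm y ^+ 2).
Proof.
move=> x1 y1; rewrite sqr_sqrtr// addr_ge0 ?sqr_ge0// mulr_ge0// ltW//;
  exact: one_sub_enorm_gt0.
Qed.

Lemma bracket_ge x y : unit_ball n x -> unit_ball n y ->
  1 - enorm x <= bracket x y /\ enorm (x - y) <= bracket x y.
Proof.
move=> x1 y1; have x0 := enorm_ge0 x; have y0 := enorm_ge0 y.
have b0 : 0 <= bracket x y by exact: sqrtr_ge0.
rewrite /unit_ball /= in x1 y1; split.
  apply: (@le_trans _ _ (1 - enorm x * enorm y)); first by nra.
  rewrite -(@ler_pXn2r _ 2)// ?nnegrE//; last by rewrite subr_ge0 mulr_ile1// ltW.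
  rewrite bracket_sq// enorm_sq !dotE (dotC y x).
  have : dot x y <= enorm x * enorm y.
    exact: le_trans (ler_norm _) (cauchy_schwarz _ _).
  rewrite -!enorm_sq; nra.
rewrite -(@ler_pXn2r _ 2)// ?nnegrE ?enorm_ge0// bracket_sq// lerDl mulr_ge0//.
  by rewrite ltW// one_sub_enorm_gt0.
by rewrite ltW// one_sub_enorm_gt0.
Qed.

Lemma bracket_gt0 x y : unit_ball n x -> unit_ball n y -> 0 < bracket x y.
Proof.
move=> x1 y1; have [h _] := bracket_ge x1 y1.
by apply: lt_le_trans h; rewrite subr_gt0.
Qed.

Lemma norm_phi_ge0 x y : 0 <= norm_phi x y.
Proof. by rewrite divr_ge0 ?enorm_ge0 ?sqrtr_ge0. Qed.

Lemma one_sub_norm_phi_sq x y : unit_ball n x -> unit_ball n y ->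
  1 - norm_phi x y ^+ 2 =
  (1 - enorm x ^+ 2) * (1 - enorm y ^+ 2) / bracket x y ^+ 2.
Proof.
move=> x1 y1; have b0 := bracket_gt0 x1 y1.
have /esym/eqP := bracket_sq x1 y1; rewrite eq_sym -subr_eq => /eqP e.
by rewrite /norm_phi expr_div_n -e; field; rewrite gt_eqF.
Qed.

Lemma norm_phi_lt1 x y : unit_ball n x -> unit_ball n y -> norm_phi x y < 1.
Proof.
move=> x1 y1; rewrite -(@expr_lt1 _ 2) ?norm_phi_ge0// -subr_gt0.
by rewrite one_sub_norm_phi_sq// !(divr_gt0, mulr_gt0) ?exprn_gt0 ?bracket_gt0//
  one_sub_enorm_gt0.
Qed.

(** The triangle inequality for [norm_phi] with denominators cleared: it is
    Cauchy-Schwarz for the points [phi_y x] and [phi_y z], whose norms are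
    [norm_phi x y] and [norm_phi z y]. *)
Lemma bracket_mul_le x y z :
  unit_ball n x -> unit_ball n y -> unit_ball n z ->
  bracket x y * bracket z y <=
    (1 - enorm y ^+ 2) * bracket x z + enorm (x - y) * enorm (z - y).
Proof.
move=> x1 y1 z1.
have y0 := one_sub_enorm_gt0 y1.
have := bracket_gt0 x1 y1; have := bracket_gt0 z1 y1.
have := bracket_gt0 x1 z1.
have xy := bracket_sq x1 y1; have zy := bracket_sq z1 y1.
have xz := bracket_sq x1 z1.
move: xy zy xz.
set A := bracket x y; set B := bracket z y; set C := bracket x z.
move=> A2 B2 C2 C0 B0 A0.
have p0 := enorm_ge0 (x - y); have q0 := enorm_ge0 (z - y).
(* U and V are phi_y x and phi_y z multiplied by A ^+ 2 and B ^+ 2. *)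
pose U := enorm (x - y) ^+ 2 *: y - (1 - enorm y ^+ 2) *: (x - y).
pose V := enorm (z - y) ^+ 2 *: y - (1 - enorm y ^+ 2) *: (z - y).
have U2 : enorm U = enorm (x - y) * A.
  apply/eqP; rewrite -(@eqrXn2 _ 2)// ?enorm_ge0 ?mulr_ge0 ?(ltW A0)//.
  rewrite exprMn A2 /U !enorm_sq !dotE (dotC y x).
  by apply/eqP; ring.
have V2 : enorm V = enorm (z - y) * B.
  apply/eqP; rewrite -(@eqrXn2 _ 2)// ?enorm_ge0 ?mulr_ge0 ?(ltW B0)//.
  rewrite exprMn B2 /V !enorm_sq !dotE (dotC y z).
  by apply/eqP; ring.
have UV : 2 * dot U V = A ^+ 2 * B ^+ 2 + enorm (x - y) ^+ 2 * enorm (z - y) ^+ 2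
   - (1 - enorm y ^+ 2) ^+ 2 * C ^+ 2.
  rewrite A2 B2 C2 !enorm_sq /U /V !enorm_sq !dotE (dotC y x) (dotC y z) (dotC z x).
  by ring.
have := le_trans (ler_norm _) (cauchy_schwarz U V).
rewrite U2 V2 => h.
have h2 : (A * B - enorm (x - y) * enorm (z - y)) ^+ 2 <=
   ((1 - enorm y ^+ 2) * C) ^+ 2.
  by rewrite sqrrB !exprMn; lra.
rewrite -lerBlDr; apply: le_trans (ler_norm _) _.
rewrite -(@ler_pXn2r _ 2)// ?nnegrE ?mulr_ge0 ?(ltW y0) ?(ltW C0)//.
by rewrite real_normK ?num_real.
Qed.

(** With [r <= s] the two values of [norm_phi], the square of [bracket_mul_le]
    amounts to [(s - r) [x,z] <= (1 - r s) |x - z|], and [r s >= r ^+ 2]. The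
    factor [1 - r ^+ 2] supplies the decay at the boundary: it raises the power
    [n - 2] in the density of the Green function to [n - 1]. *)
Lemma norm_phi_lip x y z :
  unit_ball n x -> unit_ball n y -> unit_ball n z ->
  norm_phi x y <= norm_phi z y ->
  (norm_phi z y - norm_phi x y) * (1 - enorm x) <=
    (1 - norm_phi x y ^+ 2) * enorm (x - z).
Proof.
move=> x1 y1 z1 rr.
have [C1 _] := bracket_ge x1 z1.
have C0 := bracket_gt0 x1 z1.
have A0 := bracket_gt0 x1 y1; have B0 := bracket_gt0 z1 y1.
have := bracket_mul_le x1 y1 z1.
have a0 := one_sub_enorm_gt0 x1; have b0 := one_sub_enorm_gt0 y1.
have c0 := one_sub_enorm_gt0 z1.
have C2 := bracket_sq x1 z1.
have r2 := one_sub_norm_phi_sq x1 y1.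
have s2 := one_sub_norm_phi_sq z1 y1.
have r0 := norm_phi_ge0 x y; have s0 := norm_phi_ge0 z y.
have r1 := norm_phi_lt1 x1 y1; have s1 := norm_phi_lt1 z1 y1.
have pE : enorm (x - y) = norm_phi x y * bracket x y.
  by rewrite /norm_phi divfK// gt_eqF.
have qE : enorm (z - y) = norm_phi z y * bracket z y.
  by rewrite /norm_phi divfK// gt_eqF.
have d0 := enorm_ge0 (x - z).
rewrite pE qE.
move: C1 C0 A0 B0 a0 b0 c0 C2 r2 s2 r0 s0 r1 s1 d0 rr {pE qE}.
set A := bracket x y; set B := bracket z y; set C := bracket x z.
set r := norm_phi x y; set s := norm_phi z y.
set a := 1 - enorm x ^+ 2; set b := 1 - enorm y ^+ 2; set c := 1 - enorm z ^+ 2.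
set d := enorm (x - z) => C1 C0 A0 B0 a0 b0 c0 C2 r2 s2 r0 s0 r1 s1 d0 rs h.
have h1 : (1 - r * s) * (A * B) <= b * C by lra.
have h2 : 0 <= (1 - r * s) * (A * B) by rewrite !mulr_ge0 ?ltW// subr_gt0; nra.
have h3 : (1 - r * s) ^+ 2 * (a * c) <= (1 - r ^+ 2) * (1 - s ^+ 2) * C ^+ 2.
  rewrite r2 s2.
  have -> : a * b / A ^+ 2 * (c * b / B ^+ 2) * C ^+ 2 =
     (a * c) * ((b * C) / (A * B)) ^+ 2 by field; rewrite !gt_eqF.
  rewrite mulrC; apply: ler_wpM2l; first by rewrite mulr_ge0// ltW.
  have h4 : 1 - r * s <= b * C / (A * B) by rewrite ler_pdivlMr ?mulr_gt0.
  have rs1 : 0 <= 1 - r * s by nra.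
  by rewrite ler_pXn2r// nnegrE (le_trans rs1 h4).
have h5 : (s - r) * C <= (1 - r * s) * d.
  have rs1 : r * s <= 1 by nra.
  rewrite -(@ler_pXn2r _ 2)// ?nnegrE ?mulr_ge0 ?subr_ge0 ?(ltW C0)//.
  rewrite !exprMn; move: h3; have -> : a * c = C ^+ 2 - d ^+ 2 by rewrite C2; ring.
  have -> : (1 - r ^+ 2) * (1 - s ^+ 2) = (1 - r * s) ^+ 2 - (s - r) ^+ 2 by ring.
  rewrite !mulrBl !mulrBr. lra.
have h6 : (s - r) * (1 - enorm x) <= (s - r) * C by rewrite ler_wpM2l// subr_ge0.
apply: le_trans h6 (le_trans h5 _); apply: ler_wpM2r => //; nra.
Qed.

End bracket.

(** * Comparison of Green functions *)

Section profile.
Context {R : realType} (k m : nat).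

Definition green_density (s : R) : R := (1 - s ^+ 2) ^+ k / s ^+ m.

Definition green_tail (r : R) : R :=
  \int[@lebesgue_measure R]_(s in `[r, 1]) green_density s.

Lemma green_density_ge0 s : 0 <= s <= 1 -> 0 <= green_density s.
Proof.
move=> /andP[s0 s1]; rewrite divr_ge0 ?exprn_ge0//.
by rewrite subr_ge0 exprn_ile1.
Qed.

Lemma green_density_le r s : 0 < r -> r <= s -> s <= 1 ->
  green_density s <= green_density r.
Proof.
move=> r0 rs s1; have s0 := lt_le_trans r0 rs.
have s2 : 0 <= 1 - s ^+ 2 by rewrite subr_ge0 exprn_ile1// ltW.
have sr2 : 1 - s ^+ 2 <= 1 - r ^+ 2 by nra.
apply: ler_pM.
- exact: exprn_ge0.
- by rewrite invr_ge0 exprn_ge0// ltW.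
- by apply: lerXn2r; rewrite // nnegrE// (le_trans s2).
- by rewrite lef_pV2 ?posrE ?exprn_gt0// lerXn2r// ?nnegrE ltW.
Qed.

Lemma green_density_integrable r t : 0 < r ->
  (@lebesgue_measure R).-integrable `[r, t] (EFin \o green_density).
Proof.
move=> r0; apply: continuous_compact_integrable; first exact: segment_compact.
apply: continuous_in_subspaceT => s; rewrite inE/= in_itv/= => /andP[rs _].
have s0 : s != 0 by rewrite gt_eqF// (lt_le_trans r0).
apply: cvgM.
  apply: (@continuous_comp _ _ _ (fun s : R => 1 - s ^+ 2) (fun u => u ^+ k)).
    by apply: cvgB; [exact: cvg_cst|exact: exprn_continuous].
  exact: exprn_continuous.
by apply: cvgV; [rewrite expf_neq0|exact: exprn_continuous].
Qed.

(** The density is decreasing, so its value at the left endpoint bounds the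
    integral over [[r, r']]; no intermediate point enters, which is why the
    kernels of only the two endpoints occur in [green_sub_le]. *)
Lemma green_tail_diff r r' : 0 < r -> r <= r' -> r' <= 1 ->
  0 <= green_tail r - green_tail r' <= (r' - r) * green_density r.
Proof.
move=> r0 rr' r'1.
have -> : green_tail r - green_tail r' =
    \int[@lebesgue_measure R]_(s in `[r, r']) green_density s.
  have <- : \int[@lebesgue_measure R]_(s in `]r', 1]) green_density s = green_tail r'.
    apply: Rintegral_itv_obnd_cbnd; apply: integrableS (green_density_integrable 1 r0) => //.
    by apply: subset_itvr; rewrite bnd_simp.
  rewrite /green_tail -(@Rintegral_itvB _ _ (BLeft r) (BRight 1) r'); last 3 first.
  - exact: green_density_integrable.
  - by rewrite bnd_simp.
  - by rewrite bnd_simp.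
  by rewrite opprB addrC subrK.
apply/andP; split.
  apply: Rintegral_ge0 => s; rewrite /= in_itv/= => /andP[rs sr'].
  by rewrite green_density_ge0// (le_trans (ltW r0) rs) (le_trans sr').
apply: (@le_trans _ _ (\int[@lebesgue_measure R]_(s in `[r, r']) cst (green_density r) s)).
  apply: le_Rintegral => //.
  - exact: green_density_integrable.
  - apply: continuous_compact_integrable; first exact: segment_compact.
    by apply: continuous_subspaceT => s; exact: cvg_cst.
  - move=> s; rewrite /= in_itv/= => /andP[rs sr'].
    by apply: green_density_le => //; exact: le_trans sr' r'1.
rewrite Rintegral_cst//= lebesgue_measure_itv/= lte_fin mulrC.
by case: ltgtP rr' => //= -> _; rewrite subrr.
Qed.

Lemma green_tail1 : green_tail 1 = 0.
Proof. by rewrite /green_tail set_itv1 Rintegral_set1. Qed.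

End profile.

Section green_bounds.
Context {R : realType} {n : nat} (n3 : (3 <= n)%N).
Implicit Types x y z : 'rV[R]_n.

(** Up to constants, the length of the gradient in [x] of
    [green x y * (1 - |y|^2)^(1-n)], with the bracket [[x,y]] replaced by its
    lower bound [max(1 - |x|, |x - y|)]. *)
Definition near_kernel x y : R :=
  (1 - enorm x) ^+ (n - 2) /
  (Num.max (1 - enorm x) (enorm (x - y)) * enorm (x - y)) ^+ (n - 1).

Lemma near_kernel_ge0 x y : unit_ball n x -> 0 <= near_kernel x y.
Proof.
move=> x1; rewrite divr_ge0 ?exprn_ge0//.
  by rewrite subr_ge0 ltW.
by rewrite mulr_ge0 ?enorm_ge0// le_max enorm_ge0 orbT.
Qed.

Lemma norm_phi_gt0 x y : unit_ball n x -> unit_ball n y -> x != y ->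
  0 < norm_phi x y.
Proof.
move=> x1 y1 xy; rewrite divr_gt0 ?bracket_gt0//.
by rewrite lt_def enorm_ge0 enorm_eq0 subr_eq0 xy.
Qed.

(** By [one_sub_norm_phi_sq] the quotient [(1 - r ^+ 2) / r] contains the factor
    [1 - |y|^2], which cancels the weight. *)
Lemma norm_phi_le_near_kernel x y : unit_ball n x -> unit_ball n y -> x != y ->
  ((1 - norm_phi x y ^+ 2) / norm_phi x y) ^+ (n - 1) *
    (1 - enorm y ^+ 2) ^- (n - 1) <=
  2 ^+ (n - 1) * (1 - enorm x) * near_kernel x y.
Proof.
move=> x1 y1 xy; have b0 := one_sub_enorm_gt0 y1; have a0 := one_sub_enorm_gt0 x1.
have A0 := bracket_gt0 x1 y1; have x0 := enorm_ge0 x.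
have p0 : 0 < enorm (x - y).
  by rewrite lt_def enorm_ge0 enorm_eq0 subr_eq0 xy.
have d0 : 0 < 1 - enorm x by rewrite subr_gt0.
have [h1 h2] := bracket_ge x1 y1.
rewrite -exprVn -exprMn one_sub_norm_phi_sq//.
have -> : (1 - enorm x ^+ 2) * (1 - enorm y ^+ 2) / bracket x y ^+ 2 /
    norm_phi x y / (1 - enorm y ^+ 2) =
    (1 - enorm x ^+ 2) / (bracket x y * enorm (x - y)).
  by rewrite /norm_phi; field; rewrite !gt_eqF.
rewrite /near_kernel -mulrA [X in _ <= _ * X]mulrA -exprS.
have -> : (n - 2).+1 = (n - 1)%N by rewrite -subSn// (leq_trans _ n3).
rewrite [X in _ <= X]mulrA -exprMn -expr_div_n.
have M0 : 0 < Num.max (1 - enorm x) (enorm (x - y)) by rewrite lt_max d0.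
apply: lerXn2r.
- by rewrite nnegrE divr_ge0 ?mulr_ge0// ltW.
- by rewrite nnegrE divr_ge0 ?mulr_ge0// ltW.
apply: ler_pM; rewrite ?invr_ge0 ?mulr_ge0 ?(ltW A0) ?(ltW p0) ?(ltW a0)//.
  have : enorm x < 1 by [].
  nra.
rewrite lef_pV2 ?posrE ?mulr_gt0//; apply: ler_wpM2r; first exact: ltW.
by rewrite ge_max h1 h2.
Qed.

Lemma greenE x y : green x y = n%:R^-1 * green_tail (n - 2) (n - 1) (norm_phi x y).
Proof. by []. Qed.

Lemma one_sub_sqr_mul_density (r : R) :
  (1 - r ^+ 2) * green_density (n - 2) (n - 1) r = ((1 - r ^+ 2) / r) ^+ (n - 1).
Proof.
rewrite /green_density mulrA -exprS expr_div_n.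
by congr (_ ^+ _ / _); rewrite -subSn// (leq_trans _ n3).
Qed.

Let ninv : 0 <= n%:R^-1 :> R /\ n%:R^-1 <= 1 :> R.
Proof.
split; first by rewrite invr_ge0.
by rewrite invf_le1 ?ler1n ?ltr0n (leq_trans _ n3).
Qed.

Lemma green_le x y : unit_ball n x -> unit_ball n y -> x != y ->
  `|green x y| * (1 - enorm y ^+ 2) ^- (n - 1) <= 2 ^+ (n - 1) * near_kernel x y.
Proof.
move=> x1 y1 xy; have [n0 n1] := ninv.
have r0 := norm_phi_gt0 x1 y1 xy; have r1 := norm_phi_lt1 x1 y1.
have := green_tail_diff (n - 2) (n - 1) r0 (ltW r1) (lexx 1).
rewrite green_tail1 subr0 => /andP[t0 t1].
have b0 : 0 <= (1 - enorm y ^+ 2) ^- (n - 1).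
  by rewrite invr_ge0 exprn_ge0// ltW// one_sub_enorm_gt0.
apply: (@le_trans _ _ (2 ^+ (n - 1) * (1 - enorm x) * near_kernel x y)); last first.
  rewrite ler_wpM2r ?near_kernel_ge0// ler_piMr ?exprn_ge0//.
  by rewrite gerBl enorm_ge0.
apply: le_trans (norm_phi_le_near_kernel x1 y1 xy).
apply: ler_wpM2r => //; rewrite -one_sub_sqr_mul_density greenE ger0_norm ?mulr_ge0//.
apply: (@le_trans _ _ (green_tail (n - 2) (n - 1) (norm_phi x y))).
  by rewrite ler_piMl.
apply: le_trans t1 _; apply: ler_wpM2r.
  by rewrite green_density_ge0// !ltW.
nra.
Qed.

(** Of the [n - 1] factors [1 - r ^+ 2] needed to cancel the weight, [n - 2] come
    from the density and one from [norm_phi_lip]. *)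
Lemma green_sub_le_aux x y z :
  unit_ball n x -> unit_ball n y -> unit_ball n z -> x != y ->
  norm_phi x y <= norm_phi z y ->
  `|green x y - green z y| * (1 - enorm y ^+ 2) ^- (n - 1) <=
    2 ^+ (n - 1) * enorm (x - z) * near_kernel x y.
Proof.
move=> x1 y1 z1 xy rs; have [n0 n1] := ninv.
have r0 := norm_phi_gt0 x1 y1 xy; have r1 := norm_phi_lt1 x1 y1.
have s1 := norm_phi_lt1 z1 y1.
have /andP[t0 t1] := green_tail_diff (n - 2) (n - 1) r0 rs (ltW s1).
have b0 : 0 <= (1 - enorm y ^+ 2) ^- (n - 1).
  by rewrite invr_ge0 exprn_ge0// ltW// one_sub_enorm_gt0.
have d0 : 0 < 1 - enorm x by rewrite subr_gt0.
rewrite -(ler_pM2r d0) mulrAC [X in _ <= X]mulrAC.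
have -> : 2 ^+ (n - 1) * enorm (x - z) * (1 - enorm x) * near_kernel x y =
  enorm (x - z) * (2 ^+ (n - 1) * (1 - enorm x) * near_kernel x y) by ring.
apply: le_trans (ler_wpM2l (enorm_ge0 _) (norm_phi_le_near_kernel x1 y1 xy)).
rewrite mulrA; apply: ler_wpM2r => //; rewrite -one_sub_sqr_mul_density !greenE -mulrBr.
rewrite ger0_norm ?mulr_ge0//.
have h := norm_phi_lip x1 y1 z1 rs.
have g0 : 0 <= green_density (n - 2) (n - 1) (norm_phi x y).
  by rewrite green_density_ge0// !ltW.
apply: (@le_trans _ _ ((green_tail (n - 2) (n - 1) (norm_phi x y) -
   green_tail (n - 2) (n - 1) (norm_phi z y)) * (1 - enorm x))).
  by rewrite ler_wpM2r ?(ltW d0)// ler_piMl.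
apply: le_trans (ler_wpM2r (ltW d0) t1) _.
rewrite mulrAC [X in _ <= X]mulrA; apply: ler_wpM2r => //.
by rewrite [X in _ <= X]mulrC.
Qed.

Lemma green_sub_le x y z :
  unit_ball n x -> unit_ball n y -> unit_ball n z -> x != y -> z != y ->
  `|green x y - green z y| * (1 - enorm y ^+ 2) ^- (n - 1) <=
    2 ^+ (n - 1) * enorm (x - z) * (near_kernel x y + near_kernel z y).
Proof.
move=> x1 y1 z1 xy zy.
have c0 : 0 <= 2 ^+ (n - 1) * enorm (x - z).
  by rewrite mulr_ge0 ?enorm_ge0// exprn_ge0.
have [rs|/ltW sr] := leP (norm_phi x y) (norm_phi z y).
  apply: le_trans (green_sub_le_aux x1 y1 z1 xy rs) _.
  by rewrite ler_wpM2l// lerDl near_kernel_ge0.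
rewrite distrC; apply: le_trans (green_sub_le_aux z1 y1 x1 zy sr) _.
by rewrite enorm_subC ler_wpM2l// lerDr near_kernel_ge0.
Qed.

End green_bounds.

(** * Dyadic majorant of the kernel *)

Lemma dyadic_scale (R : realType) (t : R) : 1 <= t ->
  exists k : nat, 2 ^+ k <= t <= 2 ^+ k.+1.
Proof.
move=> t1; have /andP[t2 t3] := truncn_itv (le_trans ler01 t1).
have T0 : (0 < Num.trunc t)%N.
  by rewrite lt0n; apply/eqP => T0; move: t3; rewrite T0 ltNge t1.
exists (trunc_log 2 (Num.trunc t)).
have /andP[h1 h2] := @trunc_log_bounds 2 _ isT T0.
rewrite -!natrX; apply/andP; split.
  by apply: le_trans t2; rewrite ler_nat.
by apply: le_trans (ltW t3) _; rewrite ler_nat.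
Qed.

Section dyadic_majorant.
Context {R : realType} {n : nat} (n3 : (3 <= n)%N).
Implicit Types (c x y : 'rV[R]_n) (rho delta : R).

(** Cubes rather than balls, since Lebesgue measure is explicit on boxes. *)
Definition cube c rho : set 'rV[R]_n :=
  [set v | forall i, `[c 0 i - rho, c 0 i + rho]%classic (v 0 i)].

Lemma measurable_cube c rho : measurable (cube c rho).
Proof.
apply: (@measurable_box R n (fun i => `[c 0 i - rho, c 0 i + rho]%classic)) => i.
exact: measurable_itv.
Qed.

Lemma enorm_le_cube c rho y : enorm (c - y) <= rho -> cube c rho y.
Proof.
move=> h i; rewrite /= in_itv/=.
have := le_trans (coord_le_enorm (c - y) i) h.
by rewrite !mxE ler_norml => /andP[h1 h2]; apply/andP; split; lra.
Qed.

Definition nu_density : R := (fine (lebesgue_rV n (@unit_ball R n)))^-1.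

Lemma nu_density_ge0 : 0 <= nu_density.
Proof. by rewrite invr_ge0 fine_ge0. Qed.

Lemma nu_cube c rho : 0 <= rho ->
  nu (cube c rho) = (nu_density * (2 * rho) ^+ n)%:E.
Proof.
move=> rho0; rewrite /nu /mscale /= EFinM; congr (_ * _)%E.
rewrite (@lebesgue_rV_box R n (fun i => `[c 0 i - rho, c 0 i + rho]%classic)) => [|i]; last first.
  exact: measurable_itv.
rewrite (eq_bigr (fun=> (2 * rho)%:E)) => [|i _].
  by rewrite prodEFin prodr_const card_ord.
rewrite lebesgue_measure_itv /= lte_fin.
case: ltP => [_|h]; first by rewrite -EFinB; congr EFin; ring.
have -> : rho = 0 by lra.
by rewrite mulr0.
Qed.

(** For [delta = 1 - |c|], upper bounds of [near_kernel c y] where [|c - y|] is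
    comparable to [delta / 2 ^+ k] (inner) and to [delta * 2 ^+ k] (outer). *)
Definition inner_weight delta k : R := delta ^- n * (2 * 2 ^+ k) ^+ (n - 1).
Definition outer_weight delta k : R := delta ^- n * ((2 ^+ k) ^+ 2) ^- (n - 1).

Definition layer c delta k y : R :=
  inner_weight delta k * \1_(cube c (delta / 2 ^+ k)) y +
  outer_weight delta k * \1_(cube c (delta * (2 * 2 ^+ k))) y.

Definition majorant c delta y : \bar R := (\sum_(k <oo) (layer c delta k y)%:E)%E.

Lemma inner_weight_ge0 delta k : 0 < delta -> 0 <= inner_weight delta k.
Proof.
by move=> d0; rewrite mulr_ge0// ?invr_ge0 exprn_ge0// ?mulr_ge0 ?exprn_ge0// ltW.
Qed.

Lemma outer_weight_ge0 delta k : 0 < delta -> 0 <= outer_weight delta k.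
Proof.
by move=> d0; rewrite mulr_ge0// invr_ge0 exprn_ge0// ?exprn_ge0// ltW.
Qed.

Lemma layer_ge0 c delta k y : 0 < delta -> 0 <= layer c delta k y.
Proof.
by move=> d0; rewrite addr_ge0// mulr_ge0// ?inner_weight_ge0// outer_weight_ge0.
Qed.

Lemma majorant_ge0 c delta y : 0 < delta -> (0 <= majorant c delta y)%E.
Proof. by move=> d0; apply: nneseries_ge0 => k _ _; rewrite lee_fin layer_ge0. Qed.

Lemma layer_le_majorant c delta k y : 0 < delta ->
  ((layer c delta k y)%:E <= majorant c delta y)%E.
Proof.
move=> d0; apply: le_trans (nneseries_lim_ge k.+1 _); last first.
  by move=> i _ _; rewrite lee_fin layer_ge0.
rewrite big_mkord big_ord_recr/= leeDr//.
by apply: sume_ge0 => i _; rewrite lee_fin layer_ge0.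
Qed.

Lemma inner_le_majorant c delta k y (A : R) : 0 < delta ->
  enorm (c - y) <= delta / 2 ^+ k -> A <= inner_weight delta k ->
  (A%:E <= majorant c delta y)%E.
Proof.
move=> d0 h Ak; apply: le_trans (layer_le_majorant c k y d0).
rewrite lee_fin /layer indicE mem_set ?mulr1; last exact: enorm_le_cube.
by rewrite (le_trans Ak)// lerDl mulr_ge0 ?outer_weight_ge0.
Qed.

Lemma outer_le_majorant c delta k y (A : R) : 0 < delta ->
  enorm (c - y) <= delta * (2 * 2 ^+ k) -> A <= outer_weight delta k ->
  (A%:E <= majorant c delta y)%E.
Proof.
move=> d0 h Ak; apply: le_trans (layer_le_majorant c k y d0).
rewrite lee_fin /layer [X in outer_weight _ _ * X]indicE mem_set ?mulr1; last exact: enorm_le_cube.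
by rewrite (le_trans Ak)// lerDr mulr_ge0 ?inner_weight_ge0.
Qed.

(** The inner weights are unbounded in [k] and all inner cubes contain their
    centre, so the majorant is infinite there. *)
Lemma real_le_majorant_center c delta (A : R) : 0 < delta ->
  (A%:E <= majorant c delta c)%E.
Proof.
move=> d0; pose k := Num.bound `|A * delta ^+ n|.
apply: (@inner_le_majorant _ _ k) => //.
  rewrite subrr (_ : enorm 0 = 0); last by apply/eqP; rewrite enorm_eq0.
  by rewrite divr_ge0 ?exprn_ge0// ltW.
rewrite /inner_weight mulrC ler_pdivlMr ?exprn_gt0//.
apply: (@le_trans _ _ k%:R).
  exact: le_trans (ler_norm _) (ltW (archi_boundP (normr_ge0 _))).
apply: (@le_trans _ _ (2 * 2 ^+ k)).
  by rewrite -exprS -natrX ler_nat ltnW// ltnW// ltn_expl.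
rewrite -[leLHS]expr1; apply: ler_weXn2l; last by rewrite subn_gt0 (leq_trans _ n3).
by rewrite -exprS exprn_ege1// ler1n.
Qed.

(** A single term of the series suffices: the inner or outer one of the dyadic
    scale of [|x - y| / delta]. *)
Lemma near_kernel_le_majorant x y : unit_ball n x -> x != y ->
  ((near_kernel x y)%:E <= majorant x (1 - enorm x) y)%E.
Proof.
move=> x1 xy.
have d0 : 0 < 1 - enorm x by rewrite subr_gt0.
have p0 : 0 < enorm (x - y).
  by rewrite lt_def enorm_ge0 enorm_eq0 subr_eq0 xy.
rewrite /near_kernel.
move: d0 p0; set delta := 1 - enorm x; set p := enorm (x - y) => d0 p0.
have powE (q : R) : 0 < q ->
    delta ^+ (n - 2) / (delta * (delta / q)) ^+ (n - 1) = delta ^- n * q ^+ (n - 1).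
  move=> q0; have -> : (n - 1 = (n - 2).+1)%N.
    by rewrite -subSn// (leq_trans _ n3).
  have -> : delta ^- n = delta ^- (n - 2).+2.
    by rewrite -addn2 subnK// ltnW.
  rewrite !exprMn exprVn !exprS; field.
  by rewrite !gt_eqF ?exprn_gt0.
have [pd|dp] := leP p delta.
  have [k /andP[k1 k2]] : exists k : nat, 2 ^+ k <= delta / p <= 2 ^+ k.+1.
    by apply: dyadic_scale; rewrite ler_pdivlMr// mul1r.
  have q0 : 0 < 2 ^+ k :> R by rewrite exprn_gt0.
  apply: (@inner_le_majorant _ _ k) => //.
    by rewrite ler_pdivlMr// mulrC -ler_pdivlMr.
  rewrite /inner_weight -exprS -powE ?exprn_gt0//.
  apply: ler_wpM2l; first by rewrite exprn_ge0// ltW.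
  rewrite lef_pV2 ?posrE ?exprn_gt0 ?mulr_gt0 ?invr_gt0 ?exprn_gt0//.
  apply: lerXn2r; rewrite ?nnegrE ?mulr_ge0 ?invr_ge0 ?exprn_ge0 ?(ltW d0) ?(ltW p0)//.
  rewrite ler_wpM2l ?(ltW d0)//.
  by rewrite ler_pdivrMr ?exprn_gt0// mulrC -ler_pdivrMr.
have [k /andP[k1 k2]] : exists k : nat, 2 ^+ k <= p / delta <= 2 ^+ k.+1.
  by apply: dyadic_scale; rewrite ler_pdivlMr// mul1r ltW.
have q0 : 0 < 2 ^+ k :> R by rewrite exprn_gt0.
apply: (@outer_le_majorant _ _ k) => //.
  by rewrite -exprS mulrC -ler_pdivrMr.
rewrite /outer_weight -exprVn -powE ?invr_gt0 ?exprn_gt0//.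
apply: ler_wpM2l; first by rewrite exprn_ge0// ltW.
rewrite lef_pV2 ?posrE ?exprn_gt0 ?mulr_gt0 ?invr_gt0 ?exprn_gt0//.
have h : 2 ^+ k * delta <= p by rewrite -ler_pdivlMr.
have h0 : 0 < 2 ^+ k * delta by rewrite mulr_gt0.
apply: lerXn2r; rewrite ?nnegrE ?mulr_ge0 ?invr_ge0 ?exprn_ge0 ?(ltW d0) ?(ltW p0)//.
rewrite invrK.
have -> : delta * (delta * (2 ^+ k) ^+ 2) = (2 ^+ k * delta) * (2 ^+ k * delta) by ring.
by apply: ler_pM; rewrite // ltW.
Qed.

Lemma measurable_layer c delta k (D : set 'rV[R]_n) :
  measurable_fun D (layer c delta k).
Proof.
apply: measurable_funD; apply: measurable_funM => //;
  apply: measurable_indic; exact: measurable_cube.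
Qed.

Lemma measurable_majorant c delta (D : set 'rV[R]_n) : 0 < delta ->
  measurable_fun D (majorant c delta).
Proof.
move=> d0; apply: (@ge0_emeasurable_sum _ _ _ _ _ predT) => [k x _ _|k _].
  by rewrite lee_fin layer_ge0.
by apply/measurable_EFinP; exact: measurable_layer.
Qed.

(** The powers of [delta] cancel. Besides constants, the inner term has weight
    [2^(k(n-1))] and volume [2^(-kn)], and the outer one has weight
    [2^(-2k(n-1))] and volume [2^(kn)]; the products are [2^(-k)] and
    [2^(-k(n-2))], and the latter is at most [2^(-k)] because [n >= 3]. *)
Lemma integral_layer_le c delta k (D : set 'rV[R]_n) : measurable D -> 0 < delta ->
  (\int[nu]_(y in D) (layer c delta k y)%:E <=
    (2 * 4 ^+ n * nu_density / 2 ^+ k)%:E)%E.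
Proof.
move=> mD d0.
have q0 : 0 < 2 ^+ k :> R by rewrite exprn_gt0.
have q1 : 1 <= 2 ^+ k :> R by rewrite exprn_ege1// ler1n.
have piece (w rho : R) : 0 <= w -> 0 <= rho ->
    (\int[nu]_(y in D) (w * \1_(cube c rho) y)%:E <=
     (nu_density * (w * (2 * rho) ^+ n))%:E)%E.
  move=> w0 rho0; under eq_integral do rewrite EFinM.
  rewrite ge0_integralZl_EFin//; last first.
    by apply/measurable_EFinP; apply: measurable_indic; exact: measurable_cube.
  rewrite integral_indic//; last exact: measurable_cube.
  rewrite mulrCA EFinM -(@nu_cube c)//; apply: lee_wpmul2l => //.
  have mB : measurable (cube c rho) by exact: measurable_cube.
  by apply: le_measure; rewrite ?inE//; exact: measurableI.
rewrite /layer.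
under eq_integral do rewrite EFinD.
rewrite ge0_integralD//; last 4 first.
- by move=> y _; rewrite lee_fin mulr_ge0// inner_weight_ge0.
- apply/measurable_EFinP; apply: measurable_funM => //.
  by apply: measurable_indic; exact: measurable_cube.
- by move=> y _; rewrite lee_fin mulr_ge0// outer_weight_ge0.
- apply/measurable_EFinP; apply: measurable_funM => //.
  by apply: measurable_indic; exact: measurable_cube.
have in0 := inner_weight_ge0 k d0; have out0 := outer_weight_ge0 k d0.
apply: le_trans (leeD (piece _ _ in0 _) (piece _ _ out0 _)) _.
- by rewrite divr_ge0// ltW.
- by rewrite !mulr_ge0// ltW.
rewrite -EFinD lee_fin.
have -> : 2 * 4 ^+ n * nu_density / 2 ^+ k =
  nu_density * (4 ^+ n / 2 ^+ k) + nu_density * (4 ^+ n / 2 ^+ k) by ring.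
have n0 := nu_density_ge0.
have [j nE] : exists j, n = j.+3 by exists (n - 3)%N; rewrite -addn3 subnK.
have n1E : (n - 1 = j.+2)%N by rewrite nE subSS subn0.
apply: lerD; apply: ler_wpM2l => //.
  have -> : inner_weight delta k * (2 * (delta / 2 ^+ k)) ^+ n =
      2 ^+ j.+2 * 2 ^+ n / 2 ^+ k.
    rewrite /inner_weight n1E nE.
    move: q0; set q := 2 ^+ k => q0.
    rewrite !exprMn !exprVn !exprS; field.
    by rewrite !gt_eqF ?exprn_gt0.
  rewrite ler_pM2r ?invr_gt0//.
  have -> : 4 ^+ n = 2 ^+ n * 2 ^+ n :> R by rewrite -exprMn; congr (_ ^+ _); ring.
  by rewrite ler_pM2r ?exprn_gt0// nE ler_eXn2l// ltr1n.
have -> : outer_weight delta k * (2 * (delta * (2 * 2 ^+ k))) ^+ n =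
    4 ^+ n / (2 ^+ k) ^+ j.+1.
  rewrite /outer_weight n1E nE.
  move: q0; set q := 2 ^+ k => q0.
  have -> : 2 * (delta * (2 * q)) = 4 * delta * q by ring.
  have -> : (q ^+ 2) ^+ j.+2 = q ^+ j.+3 * q ^+ j.+1.
    by rewrite -exprM -exprD; congr (_ ^+ _); rewrite mul2n -addnn !addSn !addnS.
  by rewrite !exprMn; field; rewrite !gt_eqF ?exprn_gt0.
apply: ler_wpM2l; first exact: exprn_ge0.
by rewrite lef_pV2 ?posrE ?exprn_gt0// exprS ler_peMr ?(ltW q0)// exprn_ege1.
Qed.

Lemma integral_majorant_le c delta (D : set 'rV[R]_n) : measurable D -> 0 < delta ->
  (\int[nu]_(y in D) majorant c delta y <= (4 * 4 ^+ n * nu_density)%:E)%E.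
Proof.
move=> mD d0; rewrite integral_nneseries//; last 2 first.
- by move=> k; apply/measurable_EFinP; exact: measurable_layer.
- by move=> k y _; rewrite lee_fin layer_ge0.
apply: (@le_trans _ _ (\sum_(k <oo) (4 * 4 ^+ n * nu_density / (2 ^ (k + 1))%:R)%:E)%E).
  apply: lee_nneseries => [k _ _|k _].
    by apply: integral_ge0 => y _; rewrite lee_fin layer_ge0.
  apply: le_trans (integral_layer_le c k mD d0) _.
  rewrite lee_fin addn1 natrX exprS le_eqVlt; apply/orP; left; apply/eqP.
  by field; rewrite gt_eqF// exprn_gt0.
rewrite le_eqVlt; apply/orP; left; apply/eqP.
have := @cvg_geometric_eseries_half R (4 * 4 ^+ n * nu_density) 0.
by rewrite expr0 divr1 => /cvg_lim; apply.
Qed.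

End dyadic_majorant.

(** * Measurability *)

Section borel.
Context {R : realType} {n : nat}.

(** The sigma-algebra is generated by the coordinates, so an open set has to be
    exhibited as a countable union of boxes: those with rational centre and
    radius [1 / k.+1] that it contains. *)
Lemma open_measurable_rV (U : set 'rV[R]_n) : open U -> measurable U.
Proof.
move=> oU.
pose cell (p : 'rV[rat]_n * nat) : set 'rV[R]_n :=
  [set v | forall i, `]ratr (p.1 0 i) - p.2.+1%:R^-1,
                       ratr (p.1 0 i) + p.2.+1%:R^-1[%classic (v 0 i)].
pose good (p : 'rV[rat]_n * nat) : set 'rV[R]_n :=
  if pselect (cell p `<=` U) then cell p else set0.
have -> : U = \bigcup_p good p.
  apply/seteqP; split => [x Ux|x [p _]]; last first.
    by rewrite /good; case: pselect => // cU /cU.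
  have : nbhs x U by apply: open_nbhs_nbhs; split.
  rewrite -nbhs_ballE => -[e /= e0 eU].
  (* A cell of radius 1 / k.+1 that contains x has diameter below e. *)
  have [k ke] : exists k : nat, 2 * k.+1%:R^-1 < e.
    pose k := Num.bound (2 / e); exists k.
    have h : 2 / e < k.+1%:R.
      apply: lt_trans (archi_boundP _) _; first by rewrite divr_ge0// ltW.
      by rewrite ltr_nat.
    by rewrite ltr_pdivrMr// mulrC -ltr_pdivrMr.
  have k0 : 0 < k.+1%:R^-1 :> R by rewrite invr_gt0.
  have /choice[q qx] : forall i : 'I_n, exists q : rat,
      ratr q \in `]x 0 i - k.+1%:R^-1, x 0 i + k.+1%:R^-1[.
    by move=> i; apply: rat_in_itvoo; move: k0; set w := _^-1 => k0; lra.
  pose p : 'rV[rat]_n * nat := (\row_i q i, k).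
  have cU : cell p `<=` U.
    move=> v vp; apply: eU; split=> // i j; rewrite (ord1 i) /ball/=.
    have := vp j; have := qx j; rewrite /= !in_itv/= !mxE.
    move=> /andP[a1 a2] /andP[a3 a4]; rewrite /= distrC ltr_distl; move: ke k0 a1 a2 a3 a4.
    by set w := k.+1%:R^-1 => ke k0 a1 a2 a3 a4; apply/andP; split; lra.
  exists p => //; rewrite /good; case: pselect => // _ i.
  have := qx i; rewrite /= !in_itv/= !mxE => /andP[].
  by set w := k.+1%:R^-1 => a1 a2; apply/andP; split; lra.
apply: countable_bigcupT_measurable; first exact: countableP.
move=> p; rewrite /good; case: pselect => [cU|cU]; last exact: measurable0.
apply: (@measurable_box R n (fun i => `]ratr (p.1 0 i) - p.2.+1%:R^-1,
   ratr (p.1 0 i) + p.2.+1%:R^-1[%classic)) => i.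
exact: measurable_itv.
Qed.

Lemma within_continuous_measurable_rV (D : set 'rV[R]_n) (f : 'rV[R]_n -> R) :
  measurable D -> {within D, continuous f} -> measurable_fun D f.
Proof.
move=> mD /continuousP cf.
apply: (measurability (@RGenOInfty.G R)) => [|_ [_ [r ->] <-]].
  exact: RGenOInfty.measurableE.
have /open_subspaceP[V oV] := cf _ (@interval_open R (BRight r) (BInfty R false) isT isT).
rewrite [X in _ = X -> _]setIC => <-.
by apply: measurableI => //; exact: open_measurable_rV.
Qed.

Lemma measurable_enorm (D : set 'rV[R]_n) : measurable_fun D (@enorm R n).
Proof.
apply: (@measurable_funS _ _ _ _ setT) => //.
apply: (@measurableT_comp _ _ _ _ _ _ (@Num.sqrt R)).
  by apply: continuous_measurable_fun; exact: sqrt_continuous.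
apply: measurable_sum => i; apply: measurable_funX; exact: measurable_coord.
Qed.

Lemma measurable_enorm_sub (x : 'rV[R]_n) (D : set 'rV[R]_n) :
  measurable_fun D (fun y => enorm (x - y)).
Proof.
apply: (@measurable_funS _ _ _ _ setT) => //.
apply: (@measurableT_comp _ _ _ _ _ _ (@enorm R n)); first exact: measurable_enorm.
apply/measurable_fun_coordP => i; under eq_fun do rewrite !mxE.
by apply: measurable_funB => //; exact: measurable_coord.
Qed.

Lemma measurable_inv_pos d (T : measurableType d) (D : set T) (f : T -> R) :
  measurable D -> (forall t, D t -> 0 < f t) -> measurable_fun D f ->
  measurable_fun D (fun t => (f t)^-1).
Proof.
move=> mD f0 mf.
have minv : measurable_fun (`]0, +oo[%classic : set R) (fun r : R => r^-1).
  apply: open_continuous_measurable_fun => // r.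
  rewrite inE/= in_itv/= andbT => r0; apply: cvgV => //.
  by rewrite gt_eqF.
apply: measurable_comp minv mf => //.
by move=> _ [t Dt <-]; rewrite /= in_itv/= andbT f0.
Qed.

Lemma measurable_norm_phi (x : 'rV[R]_n) : unit_ball n x ->
  measurable_fun (unit_ball n) (norm_phi x).
Proof.
move=> x1; apply: measurable_funM; first exact: measurable_enorm_sub.
apply: measurable_inv_pos.
- exact: measurable_unit_ball.
- by move=> y y1; exact: bracket_gt0.
apply: (@measurableT_comp _ _ _ _ _ _ (@Num.sqrt R)).
  by apply: continuous_measurable_fun; exact: sqrt_continuous.
apply: measurable_funD.
  by apply: measurable_funX; exact: measurable_enorm_sub.
apply: measurable_funM => //; apply: measurable_funB => //.
by apply: measurable_funX; exact: measurable_enorm.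
Qed.

End borel.

Lemma nonincreasing_in_measurable (R : realType) (D : set R) (f : R -> R) :
  is_interval D -> {in D &, nonincreasing_fun f} -> measurable_fun D f.
Proof.
move=> iD ni.
apply: (measurability (@RGenCInfty.G R)) => [|_ [_ [r ->] <-]].
  exact: RGenCInfty.measurableE.
apply: is_interval_measurable => s t /= [Ds rs] [Dt rt] u /andP[su ut].
have Du : D u by apply: (iD s t) => //; rewrite su.
split => //; move: rs rt; rewrite !in_itv/= !andbT => rs rt.
by apply: le_trans rt _; apply: ni; rewrite ?inE.
Qed.

Section green_measurable.
Context {R : realType} {n : nat}.

(** When [m >= 1] the integral diverges at [r = 0] and takes the default value
    [0] there, so that monotonicity holds on [[0, 1]] only away from [0]. *)
Lemma measurable_green_tail k m :
  measurable_fun (`[0, 1]%classic : set R) (@green_tail R k m).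
Proof.
rewrite -(@setU1itv _ _ (BRight 1) 0 false) ?bnd_simp//.
apply/measurable_funU => //; split; first exact: measurable_fun_set1.
apply: nonincreasing_in_measurable => [|r s]; first exact: interval_is_interval.
rewrite !inE/= !in_itv/= => /andP[r0 r1] /andP[s0 s1] rs.
by have /andP[] := green_tail_diff k m r0 rs s1; rewrite subr_ge0.
Qed.

Lemma measurable_green (x : 'rV[R]_n) : unit_ball n x ->
  measurable_fun (unit_ball n) (green x).
Proof.
move=> x1; apply: measurable_funM => //.
apply: measurable_comp (measurable_green_tail _ _) (measurable_norm_phi x1) => //.
by move=> _ [y y1 <-]; rewrite /= in_itv/= norm_phi_ge0 ltW// norm_phi_lt1.
Qed.

Lemma measurable_green_integrand (psi : 'rV[R]_n -> 'rV[R]_n) x i :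
  {within unit_ball n, continuous psi} -> unit_ball n x ->
  measurable_fun (unit_ball n)
    (fun y => green x y * psi y 0 i * (1 - enorm y ^+ 2) ^- n).
Proof.
move=> cpsi x1; have mB := @measurable_unit_ball R n.
apply: measurable_funM; last first.
  apply: measurable_inv_pos => //.
    by move=> y y1; rewrite exprn_gt0// one_sub_enorm_gt0.
  apply: measurable_funX; apply: measurable_funB => //.
  by apply: measurable_funX; exact: measurable_enorm.
apply: measurable_funM; first exact: measurable_green.
apply: within_continuous_measurable_rV => //.
move=> y; apply: (@cvg_comp _ _ _ psi (fun v : 'rV[R]_n => v 0 i) _ (nbhs (psi y))).
  exact: cpsi.
exact: coord_continuous.
Qed.

End green_measurable.

(** * The potential *)

Section potential.
Context {R : realType} {n : nat} (n3 : (3 <= n)%N).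
Context (psi : 'rV[R]_n -> 'rV[R]_n) (K : R) (K0 : 0 < K)
  (psi_cont : {within unit_ball n, continuous psi})
  (psi_le : forall y, unit_ball n y ->
    enorm (psi y) <= K * (1 - enorm y ^+ 2)).
Implicit Types x y z : 'rV[R]_n.

Let C : R := K * 2 ^+ (n - 1).

Let C0 : 0 < C.
Proof. by rewrite mulr_gt0// exprn_gt0. Qed.

Definition green_integrand i x y : R :=
  green x y * psi y 0 i * (1 - enorm y ^+ 2) ^- n.

Let maj x y : \bar R := majorant x (1 - enorm x) y.

(** The decay of [psi] at the boundary absorbs one power of the weight. *)
Lemma weight_le (g : R) i y : unit_ball n y ->
  `|g * psi y 0 i * (1 - enorm y ^+ 2) ^- n| <=
  K * (`|g| * (1 - enorm y ^+ 2) ^- (n - 1)).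
Proof.
move=> y1; have b0 := one_sub_enorm_gt0 y1.
rewrite !normrM (gtr0_norm (_ : 0 < _ ^- n)) ?invr_gt0 ?exprn_gt0//.
have h := le_trans (coord_le_enorm (psi y) i) (psi_le y1).
have bE : (1 - enorm y ^+ 2) ^+ n =
    (1 - enorm y ^+ 2) * (1 - enorm y ^+ 2) ^+ (n - 1).
  by rewrite -exprS subn1 prednK// (leq_trans _ n3).
apply: (@le_trans _ _ (`|g| * (K * (1 - enorm y ^+ 2)) * (1 - enorm y ^+ 2) ^- n)).
  by rewrite ler_wpM2r ?invr_ge0 ?exprn_ge0 ?(ltW b0)// ler_wpM2l.
rewrite bE le_eqVlt; apply/orP; left; apply/eqP.
by field; rewrite !gt_eqF ?exprn_gt0.
Qed.

Lemma le_mul_majorant (c A : R) (m : \bar R) : 0 < c ->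
  ((A / c)%:E <= m)%E -> (A%:E <= c%:E * m)%E.
Proof.
move=> c0 h; apply: le_trans (lee_wpmul2l _ h); last by rewrite lee_fin ltW.
by rewrite -EFinM mulrC divfK// gt_eqF.
Qed.

(** Bounding the integrand itself, and not only its increments, is needed for
    integrability: the integral of a function that is not integrable would be
    a default value, and the difference of the potentials would not be the
    integral of the difference. *)
Lemma green_integrand_le i x y : unit_ball n x -> unit_ball n y ->
  (`|green_integrand i x y|%:E <= C%:E * maj x y)%E.
Proof.
move=> x1 y1; apply: le_mul_majorant => //.
have d0 : 0 < 1 - enorm x by rewrite subr_gt0.
have [->|xy] := eqVneq y x; first exact: real_le_majorant_center.
apply: le_trans (near_kernel_le_majorant n3 x1 _); last by rewrite eq_sym.
rewrite lee_fin ler_pdivrMr// mulrC.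
apply: le_trans (weight_le _ _ y1) _; rewrite /C -mulrA ler_pM2l//.
by apply: green_le => //; rewrite eq_sym.
Qed.

(** Off the diagonals this is [green_sub_le]; at [y = x] and [y = z] one of the
    two majorants is infinite and [x != z] makes its coefficient positive. *)
Lemma green_integrand_sub_le i x y z :
  unit_ball n x -> unit_ball n y -> unit_ball n z -> x != z ->
  (`|green_integrand i x y - green_integrand i z y|%:E <=
     (C * enorm (x - z))%:E * (maj x y + maj z y))%E.
Proof.
move=> x1 y1 z1 xz.
have dx : 0 < 1 - enorm x by rewrite subr_gt0.
have dz : 0 < 1 - enorm z by rewrite subr_gt0.
have d0 : 0 < enorm (x - z).
  by rewrite lt_def enorm_ge0 enorm_eq0 subr_eq0 xz.
apply: le_mul_majorant; first by rewrite mulr_gt0.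
have [->|xy] := eqVneq y x.
  apply: le_trans (leeDl _ (majorant_ge0 _ _ dz)).
  exact: real_le_majorant_center.
have [->|zy] := eqVneq y z.
  apply: le_trans (leeDr _ (majorant_ge0 _ _ dx)).
  exact: real_le_majorant_center.
have hx := near_kernel_le_majorant n3 x1 (_ : x != y).
have hz := near_kernel_le_majorant n3 z1 (_ : z != y).
apply: le_trans (leeD (hx _) (hz _)); rewrite 1?eq_sym//.
rewrite -EFinD lee_fin ler_pdivrMr ?mulr_gt0// mulrC.
rewrite /green_integrand -mulrBl -mulrBl.
apply: le_trans (weight_le _ _ y1) _; rewrite /C -!mulrA ler_pM2l//.
by rewrite mulrA; apply: green_sub_le => //; rewrite eq_sym.
Qed.

Let S : R := 4 * 4 ^+ n * nu_density (R := R) (n := n).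

Let mB : measurable (@unit_ball R n) := @measurable_unit_ball R n.

Lemma integral_maj_le x : unit_ball n x ->
  (\int[nu]_(y in unit_ball n) maj x y <= S%:E)%E.
Proof. by move=> x1; apply: integral_majorant_le => //; rewrite subr_gt0. Qed.

Lemma green_integrand_integrable i x : unit_ball n x ->
  nu.-integrable (unit_ball n) (EFin \o green_integrand i x).
Proof.
move=> x1; have d0 : 0 < 1 - enorm x by rewrite subr_gt0.
apply/integrableP; split.
  by apply/measurable_EFinP; exact: measurable_green_integrand.
apply: (@le_lt_trans _ _ (\int[nu]_(y in unit_ball n) (C%:E * maj x y))%E).
  apply: ge0_le_integral => //.
  - apply: measurableT_comp => //.
    by apply/measurable_EFinP; exact: measurable_green_integrand.
  - by apply: emeasurable_funM => //; exact: measurable_majorant.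
  - by move=> y y1; exact: green_integrand_le.
rewrite ge0_integralZl_EFin ?(ltW C0)//; last 2 first.
- by move=> y _; exact: majorant_ge0.
- exact: measurable_majorant.
apply: le_lt_trans (lee_wpmul2l _ (integral_maj_le x1)) _.
  by rewrite lee_fin ltW.
by rewrite -EFinM ltry.
Qed.

Lemma green_potentialE i x : green_potential psi x 0 i =
  \int[nu]_(y in unit_ball n) green_integrand i x y.
Proof. by rewrite mxE. Qed.

Lemma green_potential_coord_lip i x z : unit_ball n x -> unit_ball n z ->
  `|green_potential psi x 0 i - green_potential psi z 0 i| <=
    2 * C * S * enorm (x - z).
Proof.
move=> x1 z1; have [->|xz] := eqVneq x z.
  by rewrite !subrr normr0 (_ : enorm 0 = 0) ?mulr0//; apply/eqP; rewrite enorm_eq0.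
have dx : 0 < 1 - enorm x by rewrite subr_gt0.
have dz : 0 < 1 - enorm z by rewrite subr_gt0.
have ix := green_integrand_integrable i x1.
have iz := green_integrand_integrable i z1.
have ixz := integrableB mB ix iz.
have lip_of_eq a b : a = \int[nu]_(y in unit_ball n) green_integrand i x y ->
    b = \int[nu]_(y in unit_ball n) green_integrand i z y ->
    `|a - b| <= 2 * C * S * enorm (x - z); last first.
  by apply: lip_of_eq; exact: green_potentialE.
move=> -> ->.
have -> : \int[nu]_(y in unit_ball n) green_integrand i x y -
    \int[nu]_(y in unit_ball n) green_integrand i z y =
    \int[nu]_(y in unit_ball n) (green_integrand i x y - green_integrand i z y).
  exact: (esym (RintegralB mB ix iz)).
have d0 : 0 <= C * enorm (x - z) by rewrite mulr_ge0 ?enorm_ge0// ltW.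
apply: le_trans (le_normr_Rintegral mB _) _; first exact: ixz.
have mD : measurable_fun (unit_ball n)
    (fun y => `|green_integrand i x y - green_integrand i z y|%:E).
  apply/measurable_EFinP; apply: measurableT_comp => //.
  by apply: measurable_funB; exact: measurable_green_integrand.
have h : (\int[nu]_(y in unit_ball n)
    `|green_integrand i x y - green_integrand i z y|%:E <=
    (2 * C * S * enorm (x - z))%:E)%E.
  apply: (@le_trans _ _ (\int[nu]_(y in unit_ball n)
      ((C * enorm (x - z))%:E * (maj x y + maj z y)))%E).
    apply: ge0_le_integral => //.
    - apply: emeasurable_funM => //; apply: emeasurable_funD;
        exact: measurable_majorant.
    - by move=> y y1; exact: green_integrand_sub_le.
  rewrite ge0_integralZl_EFin//; last 2 first.
  - by move=> y _; rewrite adde_ge0// majorant_ge0.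
  - by apply: emeasurable_funD; exact: measurable_majorant.
  rewrite ge0_integralD//; last 4 first.
  - by move=> y _; rewrite majorant_ge0.
  - exact: measurable_majorant.
  - by move=> y _; rewrite majorant_ge0.
  - exact: measurable_majorant.
  apply: le_trans (lee_wpmul2l _ (leeD (integral_maj_le x1) (integral_maj_le z1))) _.
    by rewrite lee_fin.
  rewrite -EFinD -EFinM lee_fin le_eqVlt; apply/orP; left; apply/eqP; ring.
rewrite -lee_fin; apply: le_trans h.
rewrite /Rintegral fineK// ge0_fin_numE; last exact: integral_ge0.
by case/integrableP : ixz.
Qed.

Lemma green_potential_lip x z : unit_ball n x -> unit_ball n z ->
  enorm (green_potential psi x - green_potential psi z) <=
    n%:R * (2 * C * S) * enorm (x - z).
Proof.
move=> x1 z1; apply: le_trans (enorm_le_sum _) _.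
rewrite -mulrA mulr_natl -[X in _ *+ X]card_ord -sumr_const.
apply: ler_sum => i _; have := green_potential_coord_lip i x1 z1.
by congr (`|_| <= _); rewrite [RHS]mxE [X in _ = _ + X]mxE.
Qed.

End potential.

Theorem theorem1p4 (R : realType) (n : nat) (M : R) (hn : (3 <= n)%N) :
  exists beta0 : R,
  forall psi : 'rV[R]_n -> 'rV[R]_n,
    {within unit_ball n, continuous psi} ->
    (forall x, unit_ball n x -> enorm (psi x) <= M * (1 - enorm x ^+ 2)) ->
    forall x y : 'rV[R]_n, unit_ball n x -> unit_ball n y ->
      enorm (green_potential psi x - green_potential psi y)
        <= beta0 * enorm (x - y).
Proof.
(* The bound on psi is weakened so that its constant is positive, whatever the
   sign of M. *)
eexists => psi cpsi hpsi x y x1 y1.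
have K0 : 0 < `|M| + 1 by rewrite ltr_wpDl.
apply: (green_potential_lip hn K0 cpsi _ x1 y1) => z z1.
apply: le_trans (hpsi z z1) _.
apply: ler_wpM2r; first exact/ltW/one_sub_enorm_gt0.
by rewrite (le_trans (ler_norm _))// lerDl.
Qed.
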